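(* Let $k\geq 3$. Then, as formal (Laurent) series in $x$ with coefficients polynomial in $p$, $$\sum_{n\geq0}\sum_{\pi\in\mathcal{I}_n(\mathcal{A}_k)}x^np^{\mathrm{fix}(\pi)} =\sum_{j=0}^{k-3}J_j(p)x^j-\frac{x^{k-3}}{2}\Bigl(p+\bigl(p(k-3)x^2-2x-p\bigr)u_0(x)\Bigr)J_{k-2}(p) -\frac{x^{k-4}}{2}\Bigl(x+p-\bigl(x^3(k-3)-px^2(k-1)+x+p\bigr)u_0(x)\Bigr)J_{k-3}(p),$$ where $u_0(x)=1/\sqrt{1-2(k-1)x^2+(k-3)^2x^4}$ (the power series with constant term $1$).
   Context: Permutations are written in one-line notation; $\mathfrak{S}_n$ is the set of permutations of $[n]=\{1,\dots,n\}$. A permutation $\pi\in\mathfrak{S}_n$ contains a pattern $\tau\in\mathfrak{S}_k$ if there are indices $i_1<\dots<i_k$ with $(\pi_{i_1},\dots,\pi_{i_k})$ order-isomorphic to $\tau$; otherwise $\pi$ avoids $\tau$; $\pi$ avoids a set $T$ of patterns if it avoids every $\tau\in T$. An involution is a permutation with $\pi_{\pi_i}=i$ for all $i$; $\mathcal{I}_n$ is the set of involutions of $[n]$ and $\mathcal{I}_n(T)$ those avoiding $T$ ($\mathcal{I}_0$ consists of the empty permutation). $\mathcal{A}_k=\{\sigma\in\mathfrak{S}_k:\sigma_1=1,\sigma_2=2\}$. $\mathrm{fix}(\pi)$ is the number of $i$ with $\pi_i=i$. $J_n(p)=\sum_{\pi\in\mathcal{I}_n}p^{\mathrm{fix}(\pi)}$;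 equivalently $J_0=1$, $J_1=p$, $J_n(p)=pJ_{n-1}(p)+(n-1)J_{n-2}(p)$ for $n\ge2$. *)

(* Defs.v *)
From HB Require Import structures.
From mathcomp Require Import all_boot all_order all_algebra all_fingroup.
Set Implicit Arguments. Unset Strict Implicit. Unset Printing Implicit Defensive.
Import Order.TTheory GRing.Theory Num.Theory.
Local Open Scope ring_scope.

(* Permutations of [n] are elements of 'S_n (values 0..n-1, one-line notation
   pi_1 ... pi_n corresponds to pi 0, ..., pi (n-1)). *)

Definition contains (n m : nat) (pi : 'S_n) (tau : 'S_m) : bool :=
  [exists f : {ffun 'I_m -> 'I_n},
    [forall i : 'I_m, forall j : 'I_m,
       ((i < j)%N ==> (f i < f j)%N) &&
       (((pi (f i) < pi (f j))%N) == ((tau i < tau j)%N))]].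

(* A_k = { sigma in S_k : sigma_1 = 1, sigma_2 = 2 } (0-indexed here). *)
Definition in_A (k : nat) (sigma : 'S_k) : bool :=
  [forall i : 'I_k, (i < 2)%N ==> (nat_of_ord (sigma i) == nat_of_ord i)].

Definition avoids_A (k n : nat) (pi : 'S_n) : bool :=
  [forall sigma : 'S_k, in_A sigma ==> ~~ contains pi sigma].

Definition involution (n : nat) (pi : 'S_n) : bool :=
  [forall i : 'I_n, pi (pi i) == i].

Definition fixcount (n : nat) (pi : 'S_n) : nat := #|[set i | pi i == i]|.

(* Polynomials in p are {poly rat}, with p = 'X. *)
Definition J (n : nat) : {poly rat} :=
  \sum_(pi : 'S_n | involution pi) 'X ^+ fixcount pi.

(* Formal power series in x with coefficients polynomials in p:
   a series s stands for sum_n s n x^n. *)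
Definition series := nat -> {poly rat}.

Definition sadd (a b : series) : series := fun n => a n + b n.
Definition ssub (a b : series) : series := fun n => a n - b n.
Definition smul (a b : series) : series :=
  fun n => \sum_(i < n.+1) a i * b (n - i)%N.
Definition sscale (c : {poly rat}) (a : series) : series := fun n => c * a n.
Definition sX (s : nat) (a : series) : series :=
  fun n => if (s <= n)%N then a (n - s)%N else 0.
Definition spoly (l : seq {poly rat}) : series := fun n => nth 0 l n.
Definition sone : series := spoly [:: 1].
Definition spow (a : series) (m : nat) : series := iter m (smul a) sone.

Definition gbin (m : nat) : rat :=
  (\prod_(i < m) (- 2^-1 - i%:R)) / (m`!)%:R.

Definition yk (k : nat) : series :=
  spoly [:: 0; 0; - (2 * (k - 1))%N%:R; 0; ((k - 3) ^ 2)%N%:R].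

(* u_0(x) = (1 + y)^(-1/2) = 1/sqrt(1 - 2(k-1)x^2 + (k-3)^2 x^4), constant term 1;
   the binomial series is well defined since y has no constant term
   (only m <= n contribute to the coefficient of x^n). *)
Definition u0 (k : nat) : series :=
  fun n => \sum_(m < n.+1) (gbin m)%:P * spow (yk k) m n.

Definition genfun (k : nat) : series :=
  fun n => \sum_(pi : 'S_n | involution pi && avoids_A k pi) 'X ^+ fixcount pi.

Definition half : {poly rat} := (2^-1 : rat)%:P.

(* x * RHS, written as a genuine power series:
   x * sum_{j=0}^{k-3} J_j x^j
   - x^{k-2}/2 (p + (p(k-3)x^2 - 2x - p) u0) J_{k-2}
   - x^{k-3}/2 (x + p - (x^3(k-3) - p x^2 (k-1) + x + p) u0) J_{k-3} *)
Definition x_times_rhs (k : nat) : series :=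
  ssub (ssub
    (sX 1 (fun j => if (j < k - 2)%N then J j else 0))
    (sX (k - 2) (sscale (half * J (k - 2))
       (sadd (spoly [:: 'X])
             (smul (spoly [:: - 'X; - 2%:R; (k - 3)%N%:R *: 'X]) (u0 k))))))
    (sX (k - 3) (sscale (half * J (k - 3))
       (ssub (spoly [:: 'X; 1])
             (smul (spoly [:: 'X; 1; - ((k - 1)%N%:R *: 'X); (k - 3)%N%:R]) (u0 k))))).

(* Main.v *)
Require Import Defs.
From HB Require Import structures.
From mathcomp Require Import all_boot all_order all_algebra all_fingroup.
From mathcomp Require Import boolp.
From mathcomp Require Import zify ring.
Import GRing.Theory Num.Theory.
Local Open Scope ring_scope.

(* Put q = k - 2 and call a point of a permutation rich if at least q points lie
   to its north-east; a permutation avoids A_k iff its rich points are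
   left-to-right minima. An involution is grown at its south-west corner, by a
   fixed point 1 or by a 2-cycle (1 j): this never changes the richness of old
   points, and preserves avoidance iff no rich point lies beyond the insertion
   slot. So if b + q is the number of positions after the last rich point, a
   2-cycle insertion sends b to each of 0, ..., b once and to b + 1 in q ways,
   while involutions without rich points satisfy N_{n+2} = q N_n from n = q - 1
   on. With v the power series root of q x^2 v^2 - (1 + (q-1) x^2) v + 1 = 0
   (kernel method), a weight W b proportional to v^b satisfies
   W b = 1 + x^2 (W 0 + ... + W b + q W (b+1)), so W b counts all descendants of
   a state b; this leaves only geometric series over N_n, and the square root
   of the discriminant of the kernel is 1 / u_0. *)

(** * Growing involutions *)

Section NorthEast.
Local Open Scope nat_scope.

Definition northeast (n : nat) (s : 'S_n) (i : 'I_n) : nat :=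
  \sum_(l < n) ((i < l) && (s i < s l)).

(** The points i and l play the two smallest letters of a pattern in A_{q+2}. Since that set
    contains every continuation, only the number of points north-east of l matters. *)
Definition avoids_rich (q n : nat) (s : 'S_n) : bool :=
  [forall i : 'I_n, forall l : 'I_n, (i < l) && (s i < s l) ==> (northeast n s l < q)].

(* One more than the position of the last rich point, 0 if there is none. *)
Definition last_rich (q n : nat) (s : 'S_n) : nat := \max_(i < n | q <= northeast n s i) i.+1.

Definition add_fix (n : nat) (s : 'S_n) : 'S_n.+1 := lift_perm ord0 ord0 s.

(* The old points are shifted by one, and those from slot j on by two; the new
   2-cycle exchanges 0 and j + 1. *)
Definition add_cycle (n : nat) (j : 'I_n.+1) (s : 'S_n) : 'S_n.+2 :=
  lift_perm ord0 (lift ord0 j) (lift_perm j ord0 s).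

End NorthEast.
Arguments northeast {n} s i.
Arguments avoids_rich q {n} s.
Arguments last_rich q {n} s.
Arguments add_fix {n} s.
Arguments add_cycle {n} j s.

Section Insertion.
Local Open Scope nat_scope.
Variable n : nat.
Implicit Types (s : 'S_n) (i l : 'I_n).

Lemma last_richP q s m :
  reflect (forall i, q <= northeast s i -> i < m) (last_rich q s <= m).
Proof. exact: bigmax_leqP. Qed.

Lemma ltn_lift (h : 'I_n.+1) i l : (lift h i < lift h l) = (i < l).
Proof. by rewrite !ltnNge leq_bump2. Qed.

Lemma sum_leq_ord (j : nat) : \sum_(l < n) (j <= l) = n - j.
Proof.
elim: n => [|m IH]; first by rewrite big_ord0.
rewrite big_ord_recr /= IH; case: leqP => /=; lia.
Qed.

Lemma sum_gtn_ord (j : nat) : \sum_(l < n) (l < j) = minn n j.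
Proof.
elim: n => [|m IH]; first by rewrite big_ord0 min0n.
rewrite big_ord_recr /= IH; case: ltnP => /=; lia.
Qed.

Lemma northeast_ub s i : northeast s i <= n - i.+1.
Proof.
rewrite -sum_leq_ord; apply: leq_sum => l _.
by case: (i < l); case: (s i < s l).
Qed.

Lemma northeast_lift_perm (i j : 'I_n.+1) s l :
  northeast (lift_perm i j s) (lift i l) =
  ((lift i l < i) && (lift j (s l) < j)) + northeast s l.
Proof.
rewrite /northeast (bigD1_ord i) //= lift_perm_lift lift_perm_id; congr addn.
by apply: eq_bigr => k _; rewrite lift_perm_lift !ltn_lift.
Qed.

Lemma northeast_lift_perm_id (i j : 'I_n.+1) s :
  northeast (lift_perm i j s) i = \sum_(l < n) ((i <= l) && (j <= s l)).
Proof.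
rewrite /northeast (bigD1_ord i) //= ltnn add0n; apply: eq_bigr => l _.
rewrite lift_perm_lift lift_perm_id /= /bump.
by case: (leqP i l); case: (leqP j (s l)) => /=; lia.
Qed.

Lemma involution_symm s i : involution s -> s (s i) = i.
Proof. by move/forallP/(_ i)/eqP. Qed.

(** Reflection in the diagonal fixes the diagram of an involution and preserves north-east
    quadrants. *)
Lemma northeast_involution s i : involution s -> northeast s (s i) = northeast s i.
Proof.
move=> sI; rewrite /northeast (reindex_inj (@perm_inj _ s)) /=; apply: eq_bigr => l _.
by rewrite !involution_symm // andbC.
Qed.

Lemma northeast_add_fix s l : northeast (add_fix s) (lift ord0 l) = northeast s l.
Proof. by rewrite northeast_lift_perm. Qed.

Lemma northeast_add_fix0 s : northeast (add_fix s) ord0 = n.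
Proof.
rewrite northeast_lift_perm_id /= -[RHS](subn0 n) -(sum_leq_ord 0).
by apply: eq_bigr.
Qed.

Lemma involution_add_fix s : involution (add_fix s) = involution s.
Proof.
apply/forallP/forallP => H i.
  move: (H (lift ord0 i)); rewrite !lift_perm_lift; by rewrite (inj_eq lift_inj).
case: (unliftP ord0 i) => [l|] ->; rewrite ?lift_perm_lift ?lift_perm_id //.
by rewrite (eqP (H l)).
Qed.

Lemma fixcountE s : fixcount s = \sum_(i < n) (s i == i).
Proof. by rewrite /fixcount -sum1dep_card big_mkcond; apply: eq_bigr => i _; case: eqP. Qed.

(** The new point lies south-west of every old one, so no old point may be rich. *)
Lemma avoids_add_fix q s : avoids_rich q (add_fix s) = (last_rich q s == 0).
Proof.
rewrite -leqn0; apply/'forall_forallP/last_richP => H.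
  move=> l ql; have:= H ord0 (lift ord0 l).
  by rewrite lift_perm_id lift_perm_lift northeast_add_fix /= ltnNge ql.
move=> i l; case: (unliftP ord0 l) => [l'|] ->; last by [].
apply/implyP => _; rewrite northeast_add_fix ltnNge; apply/negP => /H.
by rewrite ltn0.
Qed.

Lemma bigmax_lift (P : pred 'I_n.+1) (F : 'I_n.+1 -> nat) (h : 'I_n.+1) :
  \max_(i | P i) F i = maxn (P h * F h) (\max_(i | P (lift h i)) F (lift h i)).
Proof.
rewrite big_mkcond (bigD1_ord h) //= -big_mkcond /=; congr maxn.
by case: (P h); rewrite ?mul1n.
Qed.

Lemma avoids_last0 q s : last_rich q s = 0 -> avoids_rich q s.
Proof.
move=> /eqP; rewrite -leqn0 => /last_richP H.
apply/'forall_forallP => i l; apply/implyP => _; rewrite ltnNge; apply/negP => /H.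
by rewrite ltn0.
Qed.

Lemma last_rich_add_fix q s :
  last_rich q s = 0 -> last_rich q (add_fix s) = (q <= n).
Proof.
move=> s0; rewrite /last_rich (bigmax_lift _ _ ord0) /= northeast_add_fix0 muln1.
rewrite big_pred0 ?maxn0 // => i; rewrite northeast_add_fix; apply/negP => qi.
have /last_richP/(_ i qi): last_rich q s <= 0 by rewrite s0.
by rewrite ltn0.
Qed.

End Insertion.

Section InsertCycle.
Local Open Scope nat_scope.
Variable n : nat.
Implicit Types (s : 'S_n) (i l : 'I_n) (j : 'I_n.+1).

Lemma fixcount_add_fix s : fixcount (add_fix s) = (fixcount s).+1.
Proof.
rewrite !fixcountE (bigD1_ord ord0) //= lift_perm_id eqxx add1n; congr _.+1.
by apply: eq_bigr => i _; rewrite lift_perm_lift (inj_eq lift_inj).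
Qed.

Lemma add_cycle0 j s : add_cycle j s ord0 = lift ord0 j.
Proof. exact: lift_perm_id. Qed.

Lemma add_cycle_ord j s : add_cycle j s (lift ord0 j) = ord0.
Proof. by rewrite lift_perm_lift lift_perm_id; apply/val_inj. Qed.

Lemma lift_lift0 j i : lift (lift ord0 j) (lift ord0 i) = lift ord0 (lift j i).
Proof. by apply/val_inj; rewrite /= /bump /= ltnS; lia. Qed.

Lemma add_cycle_lift j s l :
  add_cycle j s (lift ord0 (lift j l)) = lift ord0 (lift j (s l)).
Proof. by rewrite !lift_perm_lift lift_lift0. Qed.

Variant add_cycle_spec j : 'I_n.+2 -> Type :=
  | AddCycle0 : add_cycle_spec j ord0
  | AddCycleOrd : add_cycle_spec j (lift ord0 j)
  | AddCycleLift l : add_cycle_spec j (lift ord0 (lift j l)).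

Lemma add_cycleP j (i : 'I_n.+2) : add_cycle_spec j i.
Proof.
case: (unliftP ord0 i) => [i'|] ->; last by constructor.
by case: (unliftP j i') => [l|] ->; constructor.
Qed.

Lemma involution_add_cycle j s : involution (add_cycle j s) = involution s.
Proof.
apply/forallP/forallP => H i.
  move: (H (lift ord0 (lift j i))); rewrite !add_cycle_lift.
  by rewrite !(inj_eq lift_inj).
case: (add_cycleP j i) => [||l]; rewrite ?add_cycle0 ?add_cycle_ord ?add_cycle0 //.
by rewrite !add_cycle_lift (eqP (H l)).
Qed.

Lemma fixcount_add_cycle j s : fixcount (add_cycle j s) = fixcount s.
Proof.
rewrite !fixcountE (bigD1_ord ord0) //= (bigD1_ord j) //=.
rewrite add_cycle0 add_cycle_ord /= !add0n.
by apply: eq_bigr => i _; rewrite add_cycle_lift !(inj_eq lift_inj).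
Qed.

Lemma northeast_add_cycle0 j s : northeast (add_cycle j s) ord0 = n - j.
Proof.
rewrite northeast_lift_perm_id /= -(subSS j) -sum_leq_ord [RHS](reindex_inj (@perm_inj _ (lift_perm j ord0 s))) /=.
by apply: eq_bigr.
Qed.

Lemma northeast_add_cycle_ord j s : northeast (add_cycle j s) (lift ord0 j) = n - j.
Proof.
rewrite northeast_lift_perm /= add0n northeast_lift_perm_id -sum_leq_ord.
by apply: eq_bigr => l _; rewrite andbT.
Qed.

Lemma northeast_add_cycle j s l : northeast (add_cycle j s) (lift ord0 (lift j l)) = northeast s l.
Proof. by rewrite !northeast_lift_perm /= andbF. Qed.

(** The new points are (0, j+1) and (j+1, 0), so an old point (l, s l) has one of them to its
    south-west iff s l >= j or l >= j. In an involution (s l, l) is an equally rich point, so both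
    conditions concern rich positions only. *)
Lemma avoids_add_cycle q j s : involution s ->
  avoids_rich q (add_cycle j s) = avoids_rich q s && (last_rich q s <= j).
Proof.
move=> sI; apply/'forall_forallP/andP => [H|[/'forall_forallP H /last_richP rj]].
  split.
    apply/'forall_forallP => i l; move: (H (lift ord0 (lift j i)) (lift ord0 (lift j l))).
    by rewrite !add_cycle_lift northeast_add_cycle !ltn_lift.
  apply/last_richP => l ql; rewrite ltnNge; apply/negP => jl.
  move: (H (lift ord0 j) (lift ord0 (lift j l))).
  rewrite add_cycle_lift add_cycle_ord northeast_add_cycle [northeast s l < q]ltnNge ql /=.
  by rewrite /bump jl /= !add1n !ltnS jl.
move=> i l; case: (add_cycleP j l) => [||l']; rewrite ?add_cycle_ord ?ltn0 ?andbF //.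
rewrite northeast_add_cycle add_cycle_lift; apply/implyP => /andP[il sil]; rewrite ltnNge; apply/negP => ql.
have lj := rj _ ql; have slj : s l' < j by apply: rj; rewrite northeast_involution.
move: il sil; case: (add_cycleP j i) => [||i'].
- rewrite add_cycle0 /= /bump /= !add1n ltnS; move: slj; lia.
- rewrite add_cycle_ord /= /bump /= !add1n ltnS; move: lj; lia.
rewrite add_cycle_lift !ltn_lift => il sil.
by move: (H i' l'); rewrite il sil ltnNge ql.
Qed.

(** Both new points have n - j points to their north-east. If they are rich, the one at position j+1
    is the last rich point; otherwise the old last rich point, lying before the slot, moves by
    one. *)
Lemma last_rich_add_cycle q j s : last_rich q s <= j ->
  last_rich q (add_cycle j s) =
  if q <= n - j then j.+2 else if last_rich q s == 0 then 0 else (last_rich q s).+1.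
Proof.
move=> lj.
have lift_small l : q <= northeast s l -> (lift ord0 (lift j l)).+1 = l.+2.
  move=> /(last_richP _ _ _ _ lj) /=; rewrite /bump; lia.
have -> : last_rich q (add_cycle j s) =
  maxn ((q <= n - j) * j.+2) (\max_(l < n | q <= northeast s l) l.+2).
  rewrite [LHS](bigmax_lift _ _ _ ord0) (bigmax_lift _ _ _ j) /=.
  rewrite northeast_add_cycle0 northeast_add_cycle_ord maxnA.
  congr maxn; first by case: (q <= n - j); rewrite ?mul0n ?mul1n.
  by apply: eq_big => [l|l]; rewrite northeast_add_cycle // => /lift_small.
have -> : \max_(l < n | q <= northeast s l) l.+2 =
  if last_rich q s == 0 then 0 else (last_rich q s).+1.
  rewrite /last_rich; elim/big_rec2: _ => // l a b _ ->; do 2!case: eqP => ?; lia.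
case: (last_rich q s =P 0) => ?; case: (q <= n - j); lia.
Qed.

Lemma last_rich_ub q s : last_rich q s != 0 -> q <= n - last_rich q s.
Proof.
rewrite /last_rich => /eqP nz.
case: (pickP (fun i => q <= northeast s i)) => [i0 qi0|H]; last first.
  by case: nz; rewrite big_pred0.
have nonempty: 0 < #|[pred i | q <= northeast s i]| by apply/card_gt0P; exists i0.
have [i qi ->] := eq_bigmax_cond (fun i : 'I_n => i.+1) nonempty.
exact: leq_trans qi (northeast_ub _ _ _).
Qed.

End InsertCycle.

(** * Avoidance in terms of rich points *)

Section Pattern.
Local Open Scope nat_scope.

Lemma ltn_sum_rank k (g : 'I_k -> nat) a b :
  (\sum_(c < k) (g c < g a) < \sum_(c < k) (g c < g b)) = (g a < g b).
Proof.
have le x y : g x <= g y -> \sum_(c < k) (g c < g x) <= \sum_(c < k) (g c < g y).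
  by move=> xy; apply: leq_sum => c _; case: (ltnP (g c) (g x)) => // /leq_trans/(_ xy) ->.
case: (ltnP (g a) (g b)) => [ab|/le]; last by rewrite ltnNge => ->.
rewrite (bigD1 a) //= ltnn add0n [X in _ < X](bigD1 a) //= ab add1n ltnS.
by apply: leq_sum => c _; case: (ltnP (g c) (g a)) => // /ltn_trans/(_ ab) ->.
Qed.

Lemma standardization k (g : 'I_k -> nat) : injective g ->
  exists tau : 'S_k, forall a, tau a = \sum_(b < k) (g b < g a) :> nat.
Proof.
move=> g_inj; pose r (a : 'I_k) := \sum_(b < k) (g b < g a).
have r_lt a : r a < k.
  rewrite -[X in _ < X]card_ord -sum1_card /r (bigD1 a) //= ltnn add0n [X in _ < X](bigD1 a) //= add1n ltnS.
  by apply: leq_sum => b _; case: (g b < g a).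
have r_inj : injective (fun a => Ordinal (r_lt a)).
  move=> a b /(congr1 val) /= ab; apply: g_inj.
  by case: (ltngtP (g a) (g b)) => //; rewrite -ltn_sum_rank -!/(r _) ab ltnn.
by exists (perm r_inj) => a; rewrite permE.
Qed.

Lemma northeast_card n (s : 'S_n) i : northeast s i = #|[pred l : 'I_n | (i < l) && (s i < s l)]|.
Proof.
by rewrite -sum1_card [RHS]big_mkcond; apply: eq_bigr => l _; rewrite inE; case: ifP.
Qed.

Lemma contains_not_avoids_rich q n (s : 'S_n) (tau : 'S_q.+2) :
  in_A tau -> contains s tau -> ~~ avoids_rich q s.
Proof.
move=> /forallP tauA /existsP[f /'forall_forallP fP].
have tau0 : tau ord0 = 0 :> nat by apply/eqP/(implyP (tauA ord0)).
have tau1 : tau (lift ord0 ord0) = 1 :> nat by apply/eqP/(implyP (tauA _)).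
have f_lt (a b : 'I_q.+2) : a < b -> f a < f b by move=> ab; case/andP: (fP a b); rewrite ab.
have s_lt (a b : 'I_q.+2) : (s (f a) < s (f b)) = (tau a < tau b).
  by case/andP: (fP a b) => _ /eqP.
apply/negP => /'forall_forallP/(_ (f ord0) (f (lift ord0 ord0))).
rewrite f_lt // s_lt tau0 tau1 /= ltnNge northeast_card => /negP[].
have f_inj : injective f.
  move=> a b fab; apply/val_inj; case: (ltngtP a b) => // /f_lt; by rewrite fab ltnn.
have card_q : #|[pred a : 'I_q.+2 | 1 < a]| = q.
  rewrite -sum1_card big_mkcond  -[RHS](addKn 2) -sum_leq_ord.
  by apply: eq_bigr => a _; rewrite inE; case: ifP.
rewrite -[X in X <= _]card_q -(card_image f_inj); apply/subset_leq_card/subsetP => x /imageP[a].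
rewrite !inE => a1 ->; rewrite f_lt // s_lt tau1 /=.
(* The values 0 and 1 are taken at positions 0 and 1, hence [tau a] exceeds 1. *)
have neq (b : 'I_q.+2) : b < 2 -> tau a != tau b :> nat.
  move=> b2; apply/negP => /eqP/val_inj/perm_inj ab.
  by move: a1; rewrite ab ltnNge -ltnS b2.
move: (neq ord0 isT) (neq (lift ord0 ord0) isT); rewrite tau0 tau1; lia.
Qed.

(** The occurrence consists of i, l and the first q points north-east of l by position. Its
    standardization satisfies [in_A] because i and l carry its two smallest values. *)
Lemma not_avoids_rich_contains q n (s : 'S_n) :
  ~~ avoids_rich q s -> exists2 tau : 'S_q.+2, in_A tau & contains s tau.
Proof.
case/forallPn => i /forallPn[l]; rewrite negb_imply -leqNgt => /andP[/andP[il sil] ql].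
pose L := [seq x : 'I_n <- enum 'I_n | (l < x) && (s l < s x)].
pose S := [:: i, l & take q L].
have sizeL : size L = northeast s l by rewrite northeast_card cardE !size_filter -enumT.
have sizeS : size S = q.+2 by rewrite /= size_take_min sizeL (minn_idPl ql).
have S_ne (x : 'I_n) : x \in take q L -> (l < x) && (s l < s x).
  by move=> /mem_take; rewrite mem_filter => /andP[].
have lt_trans : transitive (fun x y : 'I_n => x < y).
  by move=> ? ? ?; apply: ltn_trans.
have S_sorted : sorted (fun x y : 'I_n => x < y) S.
  rewrite /= il /= path_sortedE //; apply/andP; split.
    by apply/allP => x /S_ne/andP[].
  apply/take_sorted/sorted_filter => //.
  by rewrite -[sorted _ _](@sorted_map _ _ val ltn) val_enum_ord iota_ltn_sorted.
pose f (a : 'I_q.+2) := nth i S a.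
have f_lt (a b : 'I_q.+2) : a < b -> f a < f b.
  move=> ab; apply: (sorted_ltn_nth _ _ S_sorted) => //; by rewrite inE sizeS.
have f_inj : injective f.
  move=> a b fab; apply/val_inj; case: (ltngtP a b) => // /f_lt; by rewrite fab ltnn.
have sf_inj : injective (fun a => s (f a) : nat).
  by move=> a b /val_inj/perm_inj/f_inj.
have [tau tauE] := standardization _ _ sf_inj.
exists tau.
  apply/forallP => a; apply/implyP => a2; apply/eqP.
  (* With a written as the number of indices below a, the two ranks agree term by term. *)
  rewrite tauE -[RHS](minn_idPr (ltnW (ltn_ord a))) -sum_gtn_ord.
  apply: eq_bigr => b _; congr nat_of_bool.
  have sf2 : 1 < b -> s l < s (f b).
    move=> b2; have /S_ne/andP[] // : f b \in take q L.
    rewrite /f; move: b2 (ltn_ord b); case: (val b) => [|[|c]] //= _ cq.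
    by apply: mem_nth; move: sizeS => /= [->].
  move: a2 sf2; rewrite /f; case: a => -[|[|a]] //= _ _.
    by case: (val b) => [|[|c]] /= H; rewrite ?ltnn // ltnNge ltnW //=; apply: ltn_trans (H _).
  by case: (val b) => [|[|c]] /= H; rewrite ?ltnn ?sil // ltnNge ltnW // H.
apply/existsP; exists (finfun f); apply/'forall_forallP => a b.
rewrite !ffunE !tauE ltn_sum_rank eqxx andbT; apply/implyP; exact: f_lt.
Qed.

Lemma avoids_AE k n (s : 'S_n) : 2 <= k -> avoids_A k s = avoids_rich (k - 2) s.
Proof.
case: k => [|[|q]] // _; rewrite !subSS subn0.
apply/forallP/idP => [H|sA tau].
  apply/negPn/negP => /not_avoids_rich_contains[tau tauA]; apply/negP.
  exact: (implyP (H tau)).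
by apply/implyP => tauA; apply/negP => /(contains_not_avoids_rich _ _ _ _ tauA); rewrite sA.
Qed.
End Pattern.

(** * Sums over involutions, split by the image of the first point *)

Section Sums.
Variable R : comNzRingType.

Lemma lift_perm_surj n (i j : 'I_n.+1) (s : 'S_n.+1) :
  s i == j -> exists t, s == lift_perm i j t.
Proof.
move=> /eqP sij.
have /fin_all_exists[f fE] k : exists l, s (lift i k) = lift j l.
  have: j != s (lift i k) by rewrite -sij (inj_eq perm_inj) neq_lift.
  by case/unlift_some => l -> _; exists l.
have f_inj : injective f.
  by move=> k l /(congr1 (lift j)); rewrite -!fE => /perm_inj/lift_inj.
exists (perm f_inj); apply/eqP/permP => k.
case: (unliftP i k) => [l|] ->; rewrite ?lift_perm_id //.
by rewrite lift_perm_lift permE fE.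
Qed.

Lemma lift_perm_inj n (i j : 'I_n.+1) : injective (@lift_perm n i j).
Proof.
move=> s t st; apply/permP => k; apply: (@lift_inj _ j).
by rewrite -!(lift_perm_lift i) st.
Qed.

Lemma sum_lift_perm n (i j : 'I_n.+1) (F : 'S_n.+1 -> R) :
  \sum_(s : 'S_n.+1 | s i == j) F s = \sum_t F (lift_perm i j t).
Proof.
rewrite (reindex (lift_perm i j)); last first.
  (* The default [1%g] is never reached on permutations sending i to j. *)
  exists (fun s => odflt 1%g [pick t | s == lift_perm i j t]) => s sij.
    by case: pickP => [t /eqP/lift_perm_inj|/(_ s)]; rewrite ?eqxx.
  case: pickP => [t /eqP|no_t]; first by [].
  by have [t] := lift_perm_surj _ _ _ _ sij; rewrite no_t.
by apply: eq_bigl => t; rewrite lift_perm_id eqxx.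
Qed.

Lemma sum_involution n (F : 'S_n.+2 -> R) :
  \sum_(s : 'S_n.+2 | involution s) F s =
  \sum_(s : 'S_n.+1 | involution s) F (add_fix s) +
  \sum_(j < n.+1) \sum_(s : 'S_n | involution s) F (add_cycle j s).
Proof.
rewrite (partition_big (fun s : 'S_n.+2 => s ord0) predT) //= big_ord_recl.
congr (_ + _).
  rewrite (eq_bigl (fun s : 'S_n.+2 => (s ord0 == ord0) && involution s)); last first.
    by move=> s; rewrite andbC.
  rewrite big_mkcondr sum_lift_perm [RHS]big_mkcond /=; apply: eq_bigr => s _.
  by rewrite involution_add_fix.
apply: eq_bigr => j _.
rewrite (eq_bigl (fun s : 'S_n.+2 => (s ord0 == lift ord0 j) && involution s)); last first.
  by move=> s; rewrite andbC.
rewrite big_mkcondr sum_lift_perm /=.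
(* An involution sending 0 to j+1 sends j+1 back to 0, so the terms with [t j != ord0] vanish. *)
rewrite (bigID (fun t : 'S_n.+1 => t j == ord0)) /= sum_lift_perm [X in _ + X]big1; last first.
  move=> t tj; case: ifP => // /forallP/(_ ord0).
  rewrite lift_perm_id lift_perm_lift => /eqP e; case/negP: tj; apply/eqP.
  by apply: val_inj; move/(congr1 val): e; rewrite /= /bump; lia.
rewrite addr0 [RHS]big_mkcond /=; apply: eq_bigr => s _.
by rewrite -/(add_cycle j s) involution_add_cycle.
Qed.

End Sums.

(** * Transfer recurrences *)

Section Transfer.
Variables (R : comNzRingType) (p : R) (q : nat).

Definition avoider_sum (n : nat) (F : nat -> R) : R :=
  \sum_(s : 'S_n | involution s && avoids_rich q s) p ^+ fixcount s * F (last_rich q s).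

Definition poor_sum (n : nat) : R := avoider_sum n (fun m => (m == 0%N)%:R).

(* In the presence of a rich point the subtractions below are not truncated, by
   last_rich_ub. *)
Definition rich_sum (n : nat) (F : nat -> R) : R :=
  avoider_sum n (fun m => (m != 0%N)%:R * F (n - m - q)%N).

Lemma eq_avoider_sum n (F G : nat -> R) :
  (forall m, (m <= n)%N -> (m == 0)%N || (q <= n - m)%N -> F m = G m) -> avoider_sum n F = avoider_sum n G.
Proof.
move=> FG; apply: eq_bigr => s _; rewrite FG //; first by apply/last_richP => i _.
by case: eqP => //= /eqP /last_rich_ub.
Qed.

Lemma avoider_sumD n (F G : nat -> R) :
  avoider_sum n (fun m => F m + G m) = avoider_sum n F + avoider_sum n G.
Proof. by rewrite -big_split; apply: eq_bigr => s _; rewrite mulrDr. Qed.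

Lemma avoider_sumZ n (c : R) (F : nat -> R) :
  avoider_sum n (fun m => c * F m) = c * avoider_sum n F.
Proof. by rewrite mulr_sumr; apply: eq_bigr => s _; rewrite mulrCA. Qed.

Lemma poor_sumE n :
  poor_sum n = \sum_(s : 'S_n | involution s && (last_rich q s == 0)%N) p ^+ fixcount s.
Proof.
rewrite /poor_sum /avoider_sum big_mkcond [RHS]big_mkcond; apply: eq_bigr => s _.
case: eqP => [/avoids_last0->|_]; first by rewrite mulr1.
by rewrite mulr0 andbF; case: ifP.
Qed.

(** Only involutions without rich points accept a new fixed point. The argument [(q <= n.+1)%N] of F
    is a boolean read as the value 0 or 1 of [last_rich]. *)
Lemma avoider_sum_rec n (F : nat -> R) :
  avoider_sum n.+2 F =
  p * poor_sum n.+1 * F (q <= n.+1)%N +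
  avoider_sum n (fun m => \sum_(j < n.+1 | (m <= j)%N)
    F (if (q <= n - j)%N then j.+2 else if m == 0%N then 0%N else m.+1)).
Proof.
rewrite /avoider_sum big_mkcondr sum_involution; congr (_ + _).
  rewrite poor_sumE -mulrA mulr_suml mulr_sumr big_mkcondr.
  apply: eq_bigr => s sI; rewrite avoids_add_fix; case: eqP => // s0.
  by rewrite last_rich_add_fix // fixcount_add_fix exprS mulrA.
rewrite exchange_big [RHS]big_mkcondr; apply: eq_bigr => s sI /=.
under eq_bigr => j do rewrite avoids_add_cycle //.
case: (avoids_rich q s); last by rewrite big1.
rewrite mulr_sumr [RHS]big_mkcond; apply: eq_bigr => j _ /=.
by case: ifP => // sj; rewrite fixcount_add_cycle last_rich_add_cycle.
Qed.

(** In the applications t = n - j counts the old points beyond the slot: from q on, the 2-cycle is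
    rich and leads to state t - q; below q the outcome does not depend on the slot. *)
Lemma sum_threshold a (f : nat -> R) (c : R) :
  \sum_(t < a) (if (q <= t)%N then f (t - q)%N else c) =
  \sum_(t < a - q) f t + (minn a q)%:R * c.
Proof.
elim: a => [|a IH]; first by rewrite sub0n !big_ord0 min0n mul0r addr0.
rewrite big_ord_recr /= IH; case: ifP => qa.
  have -> : minn a.+1 q = q by lia.
  have -> : minn a q = q by lia.
  by rewrite subSn // big_ord_recr /= addrAC.
have -> : (a.+1 - q = 0)%N by lia.
have -> : (a - q = 0)%N by lia.
have -> : minn a.+1 q = (minn a q).+1 by lia.
by rewrite !big_ord0 -[in RHS]natr1; ring.
Qed.

Lemma sum_slots n m (F : nat -> R) : (m <= n)%N ->
  \sum_(j < n.+1 | (m <= j)%N) F j = \sum_(t < (n - m).+1) F (n - t)%N.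
Proof.
move=> mn; rewrite [RHS](big_ord_widen n.+1 (fun t => F (n - t)%N)) ?ltnS ?leq_subr //=.
rewrite (reindex_inj rev_ord_inj) /=; apply: eq_big => j /=; rewrite subSS //.
have := ltn_ord j; lia.
Qed.

(** A new fixed point would be rich, and of the n+1 slots exactly the last q leave the 2-cycle
    poor. *)
Lemma poor_sum_rec n : (q <= n.+1)%N -> poor_sum n.+2 = q%:R * poor_sum n.
Proof.
move=> qn; rewrite {1}/poor_sum avoider_sum_rec qn mulr0 add0r -avoider_sumZ.
apply: eq_avoider_sum => m mn; case: (m =P 0%N) => [-> _|m0 _] /=; last first.
  by rewrite mulr0 big1 // => j _; case: ifP.
rewrite (sum_slots n 0 (fun j => ((if q <= n - j then j.+2 else 0) == 0)%N%:R)) //.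
rewrite subn0 (eq_bigr (fun t : 'I_n.+1 => if (q <= t)%N then (fun=> 0) (t - q)%N else 1)).
  by rewrite (sum_threshold n.+1 (fun=> 0) 1) big1 // add0r mulr1 (minn_idPr qn) mulr1.
move=> t _; rewrite subKn; last by have := ltn_ord t.
by case: ifP.
Qed.

(** F is evaluated at the state b = n - m - q. Rich points first appear through a fixed point (first
    term) or a 2-cycle (second term); a state b has b + q + 1 slots, of which b + 1 lead to 0, ...,
    b and q lead to b + 1. *)
Lemma rich_sum_rec n (F : nat -> R) :
  rich_sum n.+2 F =
  (q <= n.+1)%:R * p * poor_sum n.+1 * F (n.+1 - q)%N +
  poor_sum n * \sum_(c < n.+1 - q) F c +
  rich_sum n (fun b => \sum_(c < b.+1) F c + q%:R * F b.+1).
Proof.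
rewrite {1}/rich_sum avoider_sum_rec -addrA; congr (_ + _).
  by case: (q <= n.+1)%N; rewrite /= ?subSS ?subn0; ring.
rewrite [poor_sum n * _]mulrC -avoider_sumZ -avoider_sumD.
apply: eq_avoider_sum => m mn; case: (m =P 0%N) => [-> _|m0 /= qm] /=.
  rewrite mulr1 mul0r addr0.
  rewrite (sum_slots n 0 (fun j => ((if q <= n - j then j.+2 else 0) != 0)%N%:R *
    F (n.+2 - (if q <= n - j then j.+2 else 0) - q)%N)) // subn0.
  rewrite (eq_bigr (fun t : 'I_n.+1 => if (q <= t)%N then F (t - q)%N else 0)).
    by rewrite sum_threshold mulr0 addr0.
  move=> t _; have tn : (t <= n)%N by have := ltn_ord t.
  by rewrite subKn //; case: ifP; rewrite ?mul0r // mul1r !subSS subKn.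
rewrite mulr0 add0r mul1r.
rewrite (eq_bigr (fun j : 'I_n.+1 => if (q <= n - j)%N then F (n - j - q)%N
   else F (n - m - q).+1)); last first.
  move=> j _; case: ifP => _ /=; rewrite mul1r ?subSS //.
  by congr F; lia.
rewrite (sum_slots n m (fun j => if (q <= n - j)%N then F (n - j - q)%N
   else F (n - m - q).+1)) //.
rewrite (eq_bigr (fun t : 'I_(n - m).+1 => if (q <= t)%N then F (t - q)%N
   else F (n - m - q).+1)); last first.
  by move=> t _; rewrite subKn //; have := ltn_ord t; lia.
rewrite sum_threshold subSn // (minn_idPr _) //; lia.
Qed.
End Transfer.

(** * Formal power series *)

(** Convertible to [series], so sums and Cauchy products of the statement are definitionally the
    operations of the ring built here. *)
Definition fps (R : Type) : Type := nat -> R.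

HB.instance Definition _ (R : Type) := gen_eqMixin (fps R).
HB.instance Definition _ (R : Type) := gen_choiceMixin (fps R).

Section FpsRing.
Variable R : comNzRingType.
Implicit Types a b c : fps R.

Definition fps_add a b : fps R := fun n => a n + b n.
Definition fps_opp a : fps R := fun n => - a n.
Definition fps_const (x : R) : fps R := fun n => if n is 0%N then x else 0.
Definition fps_mul a b : fps R := fun n => \sum_(i < n.+1) a i * b (n - i)%N.

Definition fps_trunc n a : {poly R} := \poly_(i < n.+1) a i.

Lemma coef_trunc n a i : (i <= n)%N -> (fps_trunc n a)`_i = a i.
Proof. by move=> lin; rewrite coef_poly ltnS lin. Qed.

(* Transfers the ring axioms from polynomials. *)
Lemma fps_mul_trunc n a b i : (i <= n)%N ->
  fps_mul a b i = (fps_trunc n a * fps_trunc n b)`_i.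
Proof.
move=> lin; rewrite coefM; apply: eq_bigr => -[j /= ji] _; rewrite !coef_trunc //; lia.
Qed.

Lemma fps_addA : associative fps_add.
Proof. by move=> a b c; apply/funext => n; apply: addrA. Qed.
Lemma fps_addC : commutative fps_add.
Proof. by move=> a b; apply/funext => n; apply: addrC. Qed.
Lemma fps_add0 : left_id (fps_const 0) fps_add.
Proof. by move=> a; apply/funext => -[|n]; apply: add0r. Qed.
Lemma fps_addN : left_inverse (fps_const 0) fps_opp fps_add.
Proof. by move=> a; apply/funext => -[|n]; apply: addNr. Qed.

HB.instance Definition _ :=
  GRing.isZmodule.Build (fps R) fps_addA fps_addC fps_add0 fps_addN.

Lemma fps_mulC : commutative fps_mul.
Proof.
by move=> a b; apply/funext => n; rewrite !(fps_mul_trunc n) // mulrC.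
Qed.

Lemma fps_mulA : associative fps_mul.
Proof.
move=> a b c; apply/funext => n.
transitivity ((fps_trunc n a * (fps_trunc n b * fps_trunc n c))`_n).
  rewrite coefM; apply: eq_bigr => -[i /= lin] _.
  by rewrite coef_trunc // (fps_mul_trunc n) // leq_subr.
rewrite mulrA coefM; apply: eq_bigr => -[i /= lin] _.
by rewrite (fps_mul_trunc n) // coef_trunc // leq_subr.
Qed.

Lemma fps_mul1 : left_id (fps_const 1) fps_mul.
Proof.
move=> a; apply/funext => n; rewrite /fps_mul big_ord_recl subn0 mul1r big1 ?addr0 //.
by move=> i _; apply: mul0r.
Qed.

Lemma fps_mulDl : left_distributive fps_mul fps_add.
Proof.
move=> a b c; apply/funext => n; rewrite /fps_add /fps_mul -big_split /=.
by apply: eq_bigr => i _; apply: mulrDl.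
Qed.

Lemma fps_oner_neq0 : fps_const 1 != 0 :> fps R.
Proof. by apply/eqP => /(congr1 (@^~ 0%N)) /eqP; rewrite /= oner_eq0. Qed.

HB.instance Definition _ :=
  GRing.Zmodule_isComNzRing.Build (fps R) fps_mulA fps_mulC fps_mul1 fps_mulDl fps_oner_neq0.

Definition fps_X : fps R := fun n => (n == 1%N)%:R.

Lemma fpsD a b n : (a + b) n = a n + b n. Proof. by []. Qed.
Lemma fpsB a b n : (a - b) n = a n - b n. Proof. by []. Qed.
Lemma fps0 n : (0 : fps R) n = 0. Proof. by case: n. Qed.
Lemma fps1 n : (1 : fps R) n = (n == 0%N)%:R. Proof. by case: n. Qed.

Lemma fps_sum (I : Type) (r : seq I) (P : pred I) (F : I -> fps R) n :
  (\sum_(i <- r | P i) F i) n = \sum_(i <- r | P i) F i n.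
Proof. by apply: (big_morph (fun a : fps R => a n)) => //; rewrite fps0. Qed.

Lemma fpsCM (x : R) a n : (fps_const x * a) n = x * a n.
Proof.
rewrite [LHS]big_ord_recl subn0 big1 ?addr0 // => i _; exact: mul0r.
Qed.

Lemma fpsXM a n : (fps_X * a) n = if n is m.+1 then a m else 0.
Proof.
rewrite [LHS]big_ord_recl mul0r add0r; case: n => [|n]; first by rewrite big_ord0.
rewrite big_ord_recl mul1r subn1 big1 ?addr0 // => i _; exact: mul0r.
Qed.

Lemma fpsXnM m a n : (fps_X ^+ m * a) n = if (m <= n)%N then a (n - m)%N else 0.
Proof.
elim: m n => [|m IH] n; first by rewrite mul1r subn0.
by rewrite exprS -mulrA fpsXM; case: n => // n; rewrite IH.
Qed.

Lemma fps_const_is_zmod_morphism : zmod_morphism fps_const.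
Proof. by move=> x y; apply/funext => -[|n] //=; rewrite fpsB /= subr0. Qed.
Lemma fps_const_is_monoid_morphism : monoid_morphism fps_const.
Proof.
by split=> // x y; apply/funext => n; rewrite fpsCM; case: n => //= n; rewrite mulr0.
Qed.
HB.instance Definition _ := GRing.isZmodMorphism.Build R (fps R) fps_const fps_const_is_zmod_morphism.
HB.instance Definition _ := GRing.isMonoidMorphism.Build R (fps R) fps_const fps_const_is_monoid_morphism.

Lemma fps_XnI m : GRing.lreg (fps_X ^+ m).
Proof.
move=> a b ab; apply/funext => n; move: (congr1 (@^~ (m + n)%N) ab).
by rewrite !fpsXnM leq_addr addKn.
Qed.

Lemma fps_divisible m a : (forall i, (i < m)%N -> a i = 0) ->
  exists b, a = fps_X ^+ m * b.
Proof.
move=> a0; exists (fun n => a (n + m)%N); apply/funext => n; rewrite fpsXnM.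
by case: leqP => [/subnK->|/a0].
Qed.

(** Identities are checked one coefficient at a time, modulo a power of X, so that only finite sums
    occur. *)
Lemma fps_coef_mod m a b n : (n < m)%N -> (exists c, a = b + fps_X ^+ m * c) -> a n = b n.
Proof. by move=> nm [c ->]; rewrite fpsD fpsXnM leqNgt nm addr0. Qed.

End FpsRing.

(** * The binomial series of exponent -1/2 *)

Section BinomialSeries.

Lemma gbinS m : m.+1%:R * gbin m.+1 = (- 2^-1 - m%:R) * gbin m.
Proof.
rewrite /gbin big_ord_recr /= factS natrM.
have m1 : m.+1%:R != 0 :> rat by rewrite pnatr_eq0.
have mf : (m`!)%:R != 0 :> rat by rewrite pnatr_eq0 -lt0n fact_gt0.
by field; rewrite mf addrC natr1 m1.
Qed.

(* The coefficient form of X (g^2)' = 2 X g g'; with gbinS, i.e. the equation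
   (1 + X) g' = - g / 2, it makes g^2 (1 + X) constant. *)
Lemma conv_derivative (c : nat -> rat) n :
  n%:R * (\sum_(i < n.+1) c i * c (n - i)%N) =
  2 * \sum_(i < n.+1) i%:R * c i * c (n - i)%N.
Proof.
rewrite mulr2n mulrDl mul1r [X in _ = _ + X](reindex_inj rev_ord_inj) -big_split mulr_sumr.
apply: eq_bigr => i _ /=; rewrite subSS subKn; last by rewrite -ltnS.
have {1}-> : n%:R = i%:R + (n - i)%:R :> rat by rewrite -natrD subnKC // -ltnS.
by ring.
Qed.

Lemma gbin_convS n : \sum_(i < n.+2) gbin i * gbin (n.+1 - i)%N =
  - \sum_(i < n.+1) gbin i * gbin (n - i)%N.
Proof.
have n1 : n.+1%:R != 0 :> rat by rewrite pnatr_eq0.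
apply: (mulfI n1); rewrite conv_derivative big_ord_recl !mul0r add0r.
rewrite (eq_bigr (fun i : 'I_n.+1 =>
  - (2^-1 * (gbin i * gbin (n - i)%N) + i%:R * gbin i * gbin (n - i)%N))); last first.
  move=> i _; rewrite subSS /= gbinS; ring.
rewrite sumrN big_split /= mulrN mulrDr -conv_derivative -mulr_sumr mulrA divff // mul1r.
by rewrite mulrN -natr1; ring.
Qed.

Lemma gbin_series_sqr : (gbin : fps rat) ^+ 2 * (1 + fps_X rat) = 1.
Proof.
apply/funext => n; rewrite mulrDr mulr1 mulrC fpsD fpsXM fps1 expr2.
case: n => [|n]; last by rewrite [X in X + _]gbin_convS addNr.
by rewrite addr0 [LHS]big_ord1 /gbin big_ord0 fact0 divr1 mulr1.
Qed.

End BinomialSeries.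

(** * Substitution of y into the binomial series *)

Section InverseSquareRoot.
Variable k : nat.
Notation T := {poly rat}.
Let y : fps T := yk k.

Lemma soneE : (sone : fps T) = 1.
Proof. by apply/funext => -[|[|n]]. Qed.

Lemma spowE (a : fps T) m : (spow a m : fps T) = a ^+ m.
Proof. by elim: m => [|m IH]; [exact: soneE | rewrite exprS -IH]. Qed.

Lemma yk_divisible : exists z : fps T, y = fps_X T ^+ 2 * z.
Proof. by apply: fps_divisible => -[|[|]]. Qed.

Definition u0_trunc M : {poly rat} := \poly_(m < M.+1) gbin m.

(** On polynomials the substitution of y is a ring morphism and raises no convergence question. *)
Definition eval_y (P : {poly rat}) : fps T := (map_poly (fps_const T \o polyC) P).[y].

(** As X^2 divides y, the powers y^m with m > n do not reach coefficient n. *)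
Lemma u0_truncP M : exists c : fps T, (u0 k : fps T) = eval_y (u0_trunc M) + fps_X T ^+ M.+1 * c.
Proof.
have [z yz] := yk_divisible.
have [|c cE] := @fps_divisible _ M.+1 ((u0 k : fps T) - eval_y (u0_trunc M)).
  move=> n nM; rewrite fpsB; apply/eqP; rewrite subr_eq0; apply/eqP.
  rewrite /eval_y /u0_trunc (@horner_coef_wide _ M.+1); last first.
    by apply: leq_trans (size_poly _ _) _; rewrite size_poly.
  rewrite fps_sum /u0 (big_ord_widen_cond M.+1 xpredT (fun m => (gbin m)%:P * spow (yk k) m n)) //=.
  rewrite big_mkcond; apply: eq_bigr => m _.
  rewrite coef_map /= coef_poly ltn_ord fpsCM spowE -/y.
  case: ltnP => // nm; rewrite yz exprMn -exprM fpsXnM ifF ?mulr0 //.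
  by apply/negbTE; rewrite -ltnNge; lia.
by exists c; rewrite -cE addrC subrK.
Qed.

Lemma u0_sqr : (u0 k : fps T) ^+ 2 * (1 + y) = 1.
Proof.
apply/funext => n; have [z yz] := yk_divisible.
apply: (@fps_coef_mod _ n.+1) => //.
(* The truncation satisfies the equation of the binomial series up to degree n. Substitution then
   turns the remainder into a multiple of y^(n+1), hence of X^(n+1). *)
have [Q QE] : exists Q : {poly rat}, u0_trunc n ^+ 2 * (1 + 'X) = 1 + Q * 'X^(n.+1).
  exists (drop_poly n.+1 (u0_trunc n ^+ 2 * (1 + 'X) - 1)).
  rewrite -[drop_poly _ _ * _]add0r -[X in _ = 1 + (X + _)](_ : take_poly n.+1 (u0_trunc n ^+ 2 * (1 + 'X) - 1) = 0).
    by rewrite poly_take_drop [RHS]addrC subrK.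
  apply/polyP => i; rewrite coef_take_poly coef0; case: ltnP => // lin.
  rewrite mulrDr mulr1 coefB coefD coefMX coef1.
  have := congr1 (fun a : fps rat => a i) gbin_series_sqr.
  rewrite mulrDr mulr1 mulrC fpsD fpsXM fps1 expr2 => <-.
  have sqE m : (m <= n)%N -> ((gbin : fps rat) * gbin) m = (u0_trunc n ^+ 2)`_m.
    by move=> mn; rewrite expr2 -(fps_mul_trunc _ n).
  by case: i lin => [|i] lin /=; rewrite !sqE ?subrr //; exact: ltnW.
have evM : {morph eval_y : P Q / P * Q} by move=> ? ?; rewrite /eval_y rmorphM hornerM.
have evD : {morph eval_y : P Q / P + Q} by move=> ? ?; rewrite /eval_y rmorphD hornerD.
have ev1 : eval_y 1 = 1 by rewrite /eval_y rmorph1 hornerC.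
have evX : eval_y 'X = y by rewrite /eval_y map_polyX hornerX.
have evXn : eval_y 'X^(n.+1) = y ^+ n.+1 by rewrite /eval_y map_polyXn hornerXn.
have := congr1 eval_y QE; rewrite expr2 !(evM, evD) ev1 evX evXn {2}yz exprMn -exprM mul2n -addnn exprD => H.
have [c ->] := u0_truncP n.
set U := eval_y (u0_trunc n) in H *; set X := fps_X T ^+ n.+1 in H *.
exists (eval_y Q * X * z ^+ n.+1 + (2 * U * c + X * c ^+ 2) * (1 + y)).
rewrite [RHS](_ : _ = 1 + eval_y Q * (X * X * z ^+ n.+1) + X * ((2 * U * c + X * c ^+ 2) * (1 + y))); last by ring.
rewrite -H; ring.
Qed.

End InverseSquareRoot.

(** * The kernel method *)

Section Kernel.
Variable S : comNzRingType.
(** Here rho = q - 1 = k - 3, u is u_0, s = 1/u is the square root of the discriminant, v the root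
    of the kernel, v r the weight of state 0, and h, i are the inverses of 2 and q. *)
Variables (x rho u s v r h i : S).
Notation q := (rho + 1).
Notation t := (x ^+ 2).
Hypothesis (tI : GRing.lreg t) (h2 : 2 * h = 1) (qi : q * i = 1).
Hypothesis (us : u * s = 1)
  (s2 : s * s = 1 - 2 * (rho + 2) * t + rho ^+ 2 * t ^+ 2)
  (vE : 2 * (q * t * v) = 1 + rho * t - s)
  (rE : 2 * (t * r) = 1 - rho * t - s).

Lemma two_lreg : GRing.lreg (2 : S).
Proof. by apply: mulrI0_lreg => a a0; rewrite -[a]mul1r -h2 mulrAC a0 mul0r. Qed.

Lemma q_lreg : GRing.lreg q.
Proof. by apply: mulrI0_lreg => a a0; rewrite -[a]mul1r -qi mulrAC a0 mul0r. Qed.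

(** Quadratic formula: 4 q t times the kernel becomes s^2 - ((1 + rho t)^2 - 4 q t), which is 0 by
    [s2]. *)
Lemma kernel_root : q * t * v ^+ 2 - (1 + rho * t) * v + 1 = 0.
Proof.
apply: tI; apply: q_lreg; apply: two_lreg; apply: two_lreg.
transitivity ((2 * (q * t * v)) ^+ 2 - 2 * (1 + rho * t) * (2 * (q * t * v)) + 4 * q * t); first by ring.
rewrite vE; transitivity (s * s - (1 + rho * t) ^+ 2 + 4 * q * t); first by ring.
rewrite s2; ring.
Qed.

(** After multiplication by 4 t the factors become the conjugates 1 - rho t - s and 1 - rho t + s,
    with product 4 t. *)
Lemma kernel_inverse : r * (1 - q * t * v) = 1.
Proof.
apply: tI; apply: two_lreg; apply: two_lreg.
transitivity (2 * (t * r) * (2 - 2 * (q * t * v))); first by ring.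
rewrite vE rE; transitivity ((1 - rho * t) ^+ 2 - s * s); first by ring.
rewrite s2; ring.
Qed.

Lemma kernel_discr : s * v = 1 - q * t * v ^+ 2.
Proof.
have -> : s = 1 + rho * t - 2 * (q * t * v) by rewrite vE; ring.
transitivity (1 - q * t * v ^+ 2 - (q * t * v ^+ 2 - (1 + rho * t) * v + 1)); first by ring.
by rewrite kernel_root subr0.
Qed.

(** The equations for b and b + 1 differ by v r v^b times the kernel; the case b = 0 fixes the
    factor r. *)
Lemma kernel_sum b :
  t * (\sum_(c < b.+1) (v * r * v ^+ c) + q * (v * r * v ^+ b.+1)) = v * r * v ^+ b - 1.
Proof.
elim: b => [|b IH].
  rewrite big_ord1 expr0 expr1 mulr1; apply/eqP; rewrite -subr_eq0; apply/eqP.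
  transitivity (1 - r * (1 - q * t * v) + r * (q * t * v ^+ 2 - (1 + rho * t) * v + 1)); first by ring.
  by rewrite kernel_root kernel_inverse subrr mulr0 addr0.
rewrite big_ord_recr /=; apply/eqP; rewrite -subr_eq0; apply/eqP.
transitivity (t * (\sum_(c < b.+1) (v * r * v ^+ c) + q * (v * r * v ^+ b.+1)) - (v * r * v ^+ b - 1)
   + v * r * v ^+ b * (q * t * v ^+ 2 - (1 + rho * t) * v + 1)); first by rewrite !exprS; ring.
by rewrite IH kernel_root subrr mulr0 addr0.
Qed.

(** The inverse of s v is u / v, and the kernel equation gives 1 / v = 1 + rho t - q t v. *)
Lemma discr_inverse :
  (1 - q * t * v ^+ 2) * (u * (1 + rho * t - q * t * v)) = 1.
Proof.
rewrite -kernel_discr.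
transitivity ((u * s) * (1 - (q * t * v ^+ 2 - (1 + rho * t) * v + 1))); first by ring.
by rewrite us kernel_root subr0 mulr1.
Qed.

(* Relates the coefficient of J_{k-2} to that of J_{k-3}: the latter starts
   the odd part of the geometric series, one factor q x v away. *)
Lemma kernel_cofactor p :
  q * t * v * (p + (- p - 2 * x + rho * p * t) * u) =
  p + x - (p + x - (rho + 2) * p * t + rho * x ^+ 3) * u.
Proof.
have sE : s = (1 - 2 * (rho + 2) * t + rho ^+ 2 * t ^+ 2) * u.
  by rewrite -s2 -mulrA [s * u]mulrC us mulr1.
apply: two_lreg; set w := - p - 2 * x + rho * p * t.
transitivity (2 * (q * t * v) * (p + w * u)); first by ring.
rewrite vE; transitivity ((1 + rho * t) * (p + w * u) - p * s - w * (u * s)); first by ring.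
rewrite us {1}sE /w; ring.
Qed.

(** K will be the geometric series over the N_n, with a = J_{k-2}, b = J_{k-3} and m = k - 3.
    Inserting u s = 1 produces s v K, known by hypothesis; then [kernel_inverse] and [rE] eliminate
    r. *)
Lemma kernel_closed p a b m K : (1 - q * t * v ^+ 2) * K = a + x * v * (q * b) ->
  x ^+ m.+2 * (v * r * (1 + p * x - q * t * v) * K) =
  - (x ^+ m.+1 * (h * a * (p + (- p - 2 * x + rho * p * t) * u)))
  - x ^+ m * (h * b * (p + x - (p + x - (rho + 2) * p * t + rho * x ^+ 3) * u)).
Proof.
rewrite -kernel_discr -kernel_cofactor => KE.
set E := p + _ * u.
have EE : 2 * (x * (v * r * (1 + p * x - q * t * v) * K)) = - E * (a + x * v * (q * b)).
  transitivity (u * s * (2 * (x * (v * r * (1 + p * x - q * t * v) * K)))).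
    by rewrite us mul1r.
  transitivity ((2 * x * (r * (1 - q * t * v)) + p * (2 * (t * r))) * (s * v * K) * u); first by ring.
  rewrite kernel_inverse rE KE.
  transitivity ((u * (2 * x + p - rho * p * t) - p * (u * s)) * (a + x * v * (q * b))); first by ring.
  by rewrite us /E; ring.
apply: two_lreg.
transitivity (x ^+ m.+1 * (2 * (x * (v * r * (1 + p * x - q * t * v) * K)))); first by rewrite !exprS; ring.
rewrite EE; transitivity (2 * h * (x ^+ m.+1 * (- E * (a + x * v * (q * b))))); first by rewrite h2 mul1r.
by rewrite !exprS; ring.
Qed.
End Kernel.

(** * Change of coefficient ring and initial values *)

Section Morphism.
Variables (R R' : comNzRingType) (f : {rmorphism R -> R'}) (p : R) (q : nat).

Lemma rmorph_avoider_sum n (F : nat -> R) :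
  f (avoider_sum R p q n F) = avoider_sum R' (f p) q n (fun m => f (F m)).
Proof.
by rewrite rmorph_sum; apply: eq_bigr => s _; rewrite rmorphM rmorphXn.
Qed.

Lemma rmorph_poor_sum n : f (poor_sum R p q n) = poor_sum R' (f p) q n.
Proof.
rewrite rmorph_avoider_sum; apply: eq_bigr => s _; by rewrite rmorph_nat.
Qed.

Lemma avoider_sum_split n :
  avoider_sum R p q n (fun=> 1) = poor_sum R p q n + rich_sum R p q n (fun=> 1).
Proof.
rewrite -avoider_sumD; apply: eq_bigr => s _; congr (_ * _).
by case: eqP; rewrite /= ?mul0r ?addr0 ?mulr1 ?add0r.
Qed.

Lemma rich_sum_small n F : (n < 2)%N -> (0 < q)%N -> rich_sum R p q n F = 0.
Proof.
move=> n2 q0; transitivity (avoider_sum R p q n (fun=> 0)).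
  apply: eq_avoider_sum => m mn; case: (m =P 0%N) => [->|m0 /= qm]; rewrite /= ?mul0r //.
  lia.
by rewrite /avoider_sum big1 // => s _; rewrite mulr0.
Qed.

(** A point has at most n - 1 < q points to its north-east. The cases n = q and n = q - 1 bring in
    J_{k-2} and J_{k-3}. *)
Lemma poor_sum_all n : (n <= q)%N -> (0 < q)%N ->
  poor_sum R p q n = \sum_(s : 'S_n | involution s) p ^+ fixcount s.
Proof.
move=> nq q0; rewrite poor_sumE; apply: eq_bigl => s.
rewrite andb_idr // => _; rewrite -leqn0; apply/last_richP => l ql.
have := northeast_ub _ s l; have := ltn_ord l; lia.
Qed.

End Morphism.

(** * Truncated generating functions of poor and rich involutions *)

Section RichSeries.
Variables (S : comNzRingType) (x p v r : S) (m : nat).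
Notation q := (m.+1).
Notation t := (x ^+ 2).
Notation N := (poor_sum S p q).
Notation B := (rich_sum S p q).
Let W b := v * r * v ^+ b.
Hypothesis WE : forall b,
  t * (\sum_(c < b.+1) W c + q%:R * W b.+1) = W b - 1.

Definition rich_gf (M : nat) (F : nat -> S) : S := \sum_(n < M) x ^+ n * B n F.
Definition poor_gf (L : nat) : S := \sum_(i < L) x ^+ i * N (q + i)%N * v ^+ i.

(** By [WE], t times the rich part of the recurrence maps W to W - 1, so the sums weighted by W
    telescope and leave the unweighted count. *)
Lemma rich_gf_rec M :
  rich_gf M (fun=> 1) = rich_gf M W - rich_gf M.+2 W +
   (\sum_(n < M) x ^+ n * (t * ((q <= n.+1)%:R * p * N n.+1 * W (n.+1 - q) +
      N n * \sum_(c < n.+1 - q) W c))).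
Proof.
have -> : rich_gf M.+2 W = \sum_(n < M) x ^+ n * (t * B n.+2 W).
  rewrite /rich_gf !big_ord_recl !rich_sum_small // !mulr0 !add0r.
  by apply: eq_bigr => n _; rewrite /= !exprS; ring.
rewrite -sumrB -big_split /=; apply: eq_bigr => n _.
rewrite rich_sum_rec /=.
set A := _ * _ * _ * _ + N n * _.
rewrite [t * (A + _)]mulrDr.
have -> : t * B n (fun b => \sum_(c < b.+1) W c + q%:R * W b.+1) = B n W - B n (fun=> 1).
  rewrite -avoider_sumZ -mulN1r -avoider_sumZ -avoider_sumD.
  apply: eq_bigr => s _; congr (_ * _).
  by rewrite mulrCA WE; ring.
ring.
Qed.

(** Two interleaved geometric series of ratio q t v^2, started by N_q and N_{q+1} = q N_m; the
    cut-off at L costs a multiple of x^L. *)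
Lemma poor_gf_discr L : exists c,
  (1 - q%:R * t * v ^+ 2) * poor_gf L = N q + x * v * (q%:R * N m) + x ^+ L * c.
Proof.
have E : poor_gf L.+2 = N q + x * v * (q%:R * N m) + q%:R * t * v ^+ 2 * poor_gf L.
  rewrite /poor_gf !big_ord_recl /= addn0 -addrA; congr (_ + _); first by rewrite /= expr0 mul1r mulr1.
  congr (_ + _).
    by rewrite addn1 poor_sum_rec // !expr1; ring.
  rewrite mulr_sumr; apply: eq_bigr => i _.
  rewrite /bump /= !add1n !addnS poor_sum_rec ?exprS; last by rewrite -addnS leq_addr.
  ring.
have : poor_gf L.+2 = poor_gf L + x ^+ L * (N (q + L)%N * v ^+ L + x * N (q + L.+1)%N * v ^+ L.+1).
  by rewrite /poor_gf !big_ord_recr /= !exprS; ring.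
rewrite E => E'.
exists (- (N (q + L)%N * v ^+ L + x * N (q + L.+1)%N * v ^+ L.+1)).
rewrite mulrBl mul1r mulrN.
apply/eqP; rewrite subr_eq; apply/eqP.
rewrite -[LHS](addrK (x ^+ L * (N (q + L)%N * v ^+ L + x * N (q + L.+1)%N * v ^+ L.+1))) -E'.
ring.
Qed.

Lemma avoider_gf L : exists c,
  \sum_(n < q + L) x ^+ n * avoider_sum S p q n (fun=> 1) =
  \sum_(n < q) x ^+ n * N n +
  x ^+ q * (v * r * (1 + p * x - q%:R * t * v) * poor_gf L) + x ^+ L * c.
Proof.
have -> : \sum_(n < q + L) x ^+ n * avoider_sum S p q n (fun=> 1) =
  \sum_(n < q + L) x ^+ n * N n + rich_gf (q + L) (fun=> 1).
  by rewrite -big_split; apply: eq_bigr => n _; rewrite avoider_sum_split mulrDr.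
rewrite rich_gf_rec.
have -> : \sum_(n < q + L) x ^+ n * (t * ((q <= n.+1)%:R * p * N n.+1 * W (n.+1 - q) +
      N n * \sum_(c < n.+1 - q) W c)) =
  p * x * (\sum_(n < (q + L).+1) (q <= n)%:R * (x ^+ n * N n * W (n - q))) +
  \sum_(n < q + L) (q <= n)%:R * (x ^+ n * N n * (W (n - q) - 1 - q%:R * t * W (n - q).+1)).
  rewrite [X in p * x * X]big_ord_recl mul0r add0r mulr_sumr -big_split.
  apply: eq_bigr => n _ /=; rewrite /bump /= add1n [x ^+ n.+1]exprS.
  case: (leqP q n) => qn; last first.
    have -> : (n.+1 - q = 0)%N by lia.
    by rewrite big_ord0 [false%:R]mulr0n mul0r; ring.
  (* [WE] read backwards evaluates the sum of the W c; its -1 later cancels the N_n with n >= q. *)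
  rewrite -[W (n - q) - 1]WE subSn // [true%:R]mulr1n; ring.
have bigL (F : nat -> S) M : \sum_(n < q + M) (q <= n)%:R * F n = \sum_(i < M) F (q + i)%N.
  rewrite big_split_ord /= big1 ?add0r.
    by apply: eq_bigr => i _; rewrite leq_addr mul1r.
  by move=> i _; rewrite leqNgt ltn_ord mul0r.
rewrite -addnS (bigL (fun n => x ^+ n * N n * W (n - q))).
rewrite (bigL (fun n => x ^+ n * N n * (W (n - q) - 1 - q%:R * t * W (n - q).+1))).
have -> : \sum_(i < L.+1) x ^+ (q + i) * N (q + i)%N * W (q + i - q) =
  x ^+ q * (v * r * (poor_gf L + x ^+ L * (N (q + L)%N * v ^+ L))).
  have -> : poor_gf L + x ^+ L * (N (q + L)%N * v ^+ L) = poor_gf L.+1.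
    by rewrite /poor_gf big_ord_recr /= mulrA.
  rewrite /poor_gf !mulr_sumr; apply: eq_bigr => i _; rewrite addKn exprD /W; ring.
have -> : \sum_(i < L) x ^+ (q + i) * N (q + i)%N *
     (W (q + i - q) - 1 - q%:R * t * W (q + i - q).+1) =
  x ^+ q * (v * r * (1 - q%:R * t * v) * poor_gf L) - \sum_(i < L) x ^+ (q + i) * N (q + i)%N.
  rewrite /poor_gf !mulr_sumr -sumrB; apply: eq_bigr => i _.
  rewrite addKn exprD /W [v ^+ i.+1]exprS; ring.
rewrite [(q + L.+1)%N]addnS.
have -> : rich_gf (q + L).+2 W = rich_gf (q + L) W +
   x ^+ L * (x ^+ q * (B (q + L)%N W + x * B (q + L).+1 W)).
  by rewrite /rich_gf !big_ord_recr /= !exprS !exprD; ring.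
rewrite big_split_ord /=.
exists (p * x * (x ^+ q * (v * r * (N (q + L)%N * v ^+ L))) - x ^+ q * (B (q + L)%N W + x * B (q + L).+1 W)).
ring.
Qed.

End RichSeries.

(** * The generating function *)

Section SeriesTranslation.
Notation T := {poly rat}.
Notation X := (fps_X T).
Notation C := (fps_const T).

Lemma saddE (a b : fps T) : sadd a b = a + b :> fps T. Proof. by []. Qed.
Lemma ssubE (a b : fps T) : ssub a b = a - b :> fps T. Proof. by []. Qed.
Lemma smulE (a b : fps T) : smul a b = a * b :> fps T. Proof. by []. Qed.

Lemma sscaleE c (a : fps T) : sscale c a = C c * a :> fps T.
Proof. by apply/funext => n; rewrite fpsCM. Qed.

Lemma sXE m (a : fps T) : sX m a = X ^+ m * a :> fps T.
Proof. by apply/funext => n; rewrite fpsXnM. Qed.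

Lemma spoly_cons c l : spoly (c :: l) = C c + X * (spoly l : fps T) :> fps T.
Proof.
by apply/funext => -[|n]; rewrite fpsD fpsXM /= ?addr0 ?add0r.
Qed.

Lemma spoly_nil : spoly [::] = 0 :> fps T.
Proof. by apply/funext => n; rewrite fps0 /spoly nth_nil. Qed.

Definition spolyE := (spoly_cons, spoly_nil).

Lemma fps_head M (a : fps T) : exists c : fps T,
  a = \sum_(n < M) X ^+ n * C (a n) + X ^+ M * c.
Proof.
have [|c cE] := @fps_divisible T M (a - \sum_(n < M) X ^+ n * C (a n)).
  move=> i iM; rewrite fpsB fps_sum (bigD1 (Ordinal iM)) //= fpsXnM leqnn subnn big1 ?addr0 ?subrr //.
  move=> j ji; rewrite fpsXnM; case: leqP => // le_ji; rewrite /fps_const.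
  case E: (i - j)%N => [|d] //; case/eqP: ji; apply/val_inj => /=; lia.
by exists c; rewrite -cE addrC subrK.
Qed.

Lemma head_fps q (F : nat -> T) :
  ((fun j => if (j < q)%N then F j else 0) : fps T) = \sum_(n < q) X ^+ n * C (F n).
Proof.
apply/funext => i; rewrite fps_sum; case: ltnP => iq.
  rewrite (bigD1 (Ordinal iq)) //= fpsXnM leqnn subnn big1 ?addr0 //.
  move=> j ji; rewrite fpsXnM; case: leqP => // le_ji; rewrite /fps_const.
  by case E: (i - j)%N => [|d] //; case/eqP: ji; apply/val_inj => /=; lia.
rewrite big1 // => j _; rewrite fpsXnM; case: leqP => // le_ji; rewrite /fps_const.
by case E: (i - j)%N => [|d] //; have := ltn_ord j; lia.
Qed.

Lemma ykE m : 1 + (yk m.+3 : fps T) =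
  1 - 2 * (m%:R + 2) * X ^+ 2 + m%:R ^+ 2 * X ^+ 2 ^+ 2.
Proof.
rewrite /yk !spolyE !rmorphN !rmorph_nat rmorph0 !subSS !subn0 natrM natrX -natr1; ring.
Qed.

Lemma rhsE m (P := C 'X) (u : fps T := u0 m.+3) (h := C Defs.half) :
  x_times_rhs m.+3 =
  X * (\sum_(n < m.+1) X ^+ n * C (J n))
  - X ^+ m.+1 * (h * C (J m.+1) * (P + (- P - 2 * X + m%:R * P * X ^+ 2) * u))
  - X ^+ m * (h * C (J m) * (P + X - (P + X - (m%:R + 2) * P * X ^+ 2 + m%:R * X ^+ 3) * u))
  :> fps T.
Proof.
rewrite /x_times_rhs !subSS !subn0 !ssubE !sXE head_fps !sscaleE !saddE !smulE.
have CN a : C (- a) = - C a by exact: rmorphN.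
have CM a b : C (a * b) = C a * C b by exact: rmorphM.
have Cn n : C n%:R = n%:R by exact: rmorph_nat.
have CZ n : C (n%:R *: 'X) = n%:R * P by rewrite -(Cn n) -CM mulr_natl scaler_nat.
have C1 : C 1 = 1 by [].
rewrite !spolyE !CN !CM !CZ !Cn C1 -/P -/u -/h -natr1; ring.
Qed.

End SeriesTranslation.

(** * Comparison of the two sides *)

Section Assembly.
Notation T := {poly rat}.
Notation X := (fps_X T).
Notation C := (fps_const T).
Variable m : nat.
Let u : fps T := u0 m.+3.

(** Without a linear term in u, the series 1 - s can be divided by X^2, as v and r require. *)
Lemma u0_head : exists c : fps T, u = 1 + X ^+ 2 * c.
Proof.
have [|c cE] := @fps_divisible T 2 (u - 1).
  case=> [|[|//]] _; rewrite fpsB fps1 /u /u0.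
    by rewrite big_ord1 /gbin big_ord0 fact0 divr1 mul1r subrr.
  rewrite !big_ord_recl big_ord0 /=.
  rewrite -[smul _ _ _]/(((yk m.+3 : fps T) * (sone : fps T)) 1%N) soneE mulr1.
  by rewrite /sone /yk /spoly /= !mulr0 !addr0 subr0.
by exists c; rewrite -cE addrC subrK.
Qed.

Lemma genfunE n : genfun m.+3 n = avoider_sum T 'X m.+1 n (fun=> 1).
Proof.
apply: eq_big => [s|s _]; first by rewrite avoids_AE.
by rewrite mulr1.
Qed.

Lemma genfun_eq : X * (genfun m.+3 : fps T) = x_times_rhs m.+3.
Proof.
set h := C Defs.half; pose i : fps T := C ((m.+1%:R)^-1)%:P; set rho : fps T := m%:R.
have h2 : 2 * h = 1.
  by rewrite /h -(rmorph_nat C) -rmorphM /Defs.half -(rmorph_nat polyC) -rmorphM divff.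
have qi : (rho + 1) * i = 1.
  by rewrite /rho natr1 -(rmorph_nat C) -rmorphM -(rmorph_nat polyC) -rmorphM divff ?pnatr_eq0.
pose D : fps T := 1 - 2 * (rho + 2) * X ^+ 2 + rho ^+ 2 * X ^+ 2 ^+ 2.
have u2D : u ^+ 2 * D = 1 by rewrite /D /rho -ykE u0_sqr.
have [c cE] := u0_head.
(* As u^2 D = 1, this is both 1/u and a square root of D. *)
pose s := D * u.
have us : u * s = 1 by rewrite -u2D /s; ring.
have s2 : s * s = D by transitivity (D * (u ^+ 2 * D)); [rewrite /s; ring|rewrite u2D mulr1].
pose w := 2 * (rho + 2) - rho ^+ 2 * X ^+ 2 - D * c.
have sE : s = 1 - X ^+ 2 * w by rewrite /s cE /w /D; ring.
(* The division by X^2 is already carried out here, through w = (1 - s) / X^2. *)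
pose v := h * i * (rho + w); pose r := h * (w - rho).
have vE : 2 * ((rho + 1) * X ^+ 2 * v) = 1 + rho * X ^+ 2 - s.
  transitivity ((2 * h) * ((rho + 1) * i) * (X ^+ 2 * (rho + w))); first by rewrite /v; ring.
  by rewrite h2 qi sE; ring.
have rE : 2 * (X ^+ 2 * r) = 1 - rho * X ^+ 2 - s.
  transitivity ((2 * h) * (X ^+ 2 * (w - rho))); first by rewrite /r; ring.
  by rewrite h2 sE; ring.
have tI := @fps_XnI T 2.
have qE : m.+1%:R = rho + 1 :> fps T by rewrite natr1.
have WE b := kernel_sum _ _ _ _ _ _ _ _ tI h2 qi s2 vE rE b.
rewrite rhsE -/u -/h -/rho.
apply/funext => n.
have [g gE] := fps_head (m.+1 + n) (genfun m.+3).
have WE' b : X ^+ 2 * (\sum_(l < b.+1) v * r * v ^+ l + m.+1%:R * (v * r * v ^+ b.+1)) =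
    v * r * v ^+ b - 1 by rewrite qE WE.
have [c1 c1E] := avoider_gf _ X (C 'X) v r m WE' n.
have [c2 c2E] := poor_gf_discr _ X (C 'X) v m n.
have poorE l : (l <= m.+1)%N -> poor_sum (fps T) (C 'X) m.+1 l = C (J l).
  by move=> lm; rewrite -rmorph_poor_sum poor_sum_all.
have headE : \sum_(l < m.+1 + n) X ^+ l * C (genfun m.+3 l) =
  \sum_(l < m.+1 + n) X ^+ l * avoider_sum (fps T) (C 'X) m.+1 l (fun=> 1).
  apply: eq_bigr => l _; by rewrite genfunE rmorph_avoider_sum rmorph1.
have poor_headE : \sum_(l < m.+1) X ^+ l * poor_sum (fps T) (C 'X) m.+1 l =
  \sum_(l < m.+1) X ^+ l * C (J l).
  by apply: eq_bigr => l _; rewrite poorE // ltnW.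
rewrite headE c1E poor_headE in gE.
rewrite !poorE // qE in c2E.
have DI := discr_inverse _ _ _ _ _ _ _ _ tI h2 qi us s2 vE.
set I := u * _ in DI; set K := poor_gf _ _ _ _ _ _ in gE c2E.
(* The truncated sum K fits [kernel_closed] only up to X^n c2; the inverse I of 1 - q X^2 v^2 makes
   the correction exact. *)
have KE : (1 - (rho + 1) * X ^+ 2 * v ^+ 2) * (K - I * (X ^+ n * c2)) =
  C (J m.+1) + X * v * ((rho + 1) * C (J m)).
  by rewrite mulrBr [_ * (I * _)]mulrA DI c2E; ring.
have closed := kernel_closed _ _ _ _ _ _ _ _ _ tI h2 qi us s2 vE rE (C 'X) _ _ m _ KE.
apply: (@fps_coef_mod _ n.+1) => //.
(* Each error term carries X^n, and the factor X in front of the generating function raises this to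
   X^(n+1). *)
exists (c1 + X ^+ m.+1 * (g + v * r * (1 + C 'X * X - (rho + 1) * X ^+ 2 * v) * I * c2)).
rewrite -[X in _ = X + _]addrA -closed gE qE exprD !exprS; ring.
Qed.

End Assembly.

(* Both sides multiplied by x (so the Laurent term x^{k-4} becomes x^{k-3}):
   coefficientwise equality of x * LHS and x * RHS. *)
Theorem theorem1p1 (k : nat) : (3 <= k)%N ->
  forall n : nat, sX 1 (genfun k) n = x_times_rhs k n.
Proof.
case: k => [|[|[|m]]] // _ n.
by rewrite -genfun_eq sXE expr1.
Qed.
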